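(* Let $\mu_1,\mu_2$ be nonzero almost periodic discrete complex measures on $\mathbb{R}^p$ with countable supports such that $\inf_{x\in\operatorname{supp}\mu_1}|\mu_1(x)|>0$ and $\inf_{x\in\operatorname{supp}\mu_2}|\mu_2(x)|>0$. Suppose that the set of differences $\{x-y:\ x\in\operatorname{supp}\mu_1,\ y\in\operatorname{supp}\mu_2\}$ is discrete. Then the two supports are finite unions of translates of one and the same full-rank lattice; that is, there exist a full-rank lattice $L\subset\mathbb{R}^p$, positive integers $r_1,r_2$ and points $c_k^j\in\mathbb{R}^p$ ($j=1,2$, $k=1,\dots,r_j$) such that $\operatorname{supp}\mu_j=\bigcup_{k=1}^{r_j}(L+c_k^j)$ for $j=1,2$.
   Context: A continuous function $f$ on $\mathbb{R}^p$ is almost periodic if for every $\varepsilon>0$ the set $\{\tau\in\mathbb{R}^p:\ \sup_{x\in\mathbb{R}^p}|f(x+\tau)-f(x)|<\varepsilon\}$ is relatively dense, i.e. there is $l=l(\varepsilon)$ such that every ball of radius $l$ contains a point of this set. A complex (locally finite) measure $\mu$ on $\mathbb{R}^p$ is almost periodic if for every continuous compactly supported function $\varphi$ on $\mathbb{R}^p$ the function $x\mapsto\int\varphi(x+t)\,d\mu(t)$ is almost periodic on $\mathbb{R}^p$. A discrete measure with countable support is a purely atomic measure $\mu=\sum_{x}\mu(x)\delta_x$ over countably many points, where $\mu(x)=\mu(\{x\})$; its support is the set of points $x$ with $\mu(x)\neq0$. A set in $\mathbb{R}^p$ is called discrete here if every ball contains only finitely many of its points. A full-rank lattice in $\mathbb{R}^p$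 is a set $L=A(\mathbb{Z}^p)$ with $A$ a non-degenerate linear operator on $\mathbb{R}^p$. *)

(* Defs.v *)
From HB Require Import structures.
From mathcomp Require Import all_boot all_order all_algebra.
From mathcomp Require Import all_classical all_reals all_analysis.
From mathcomp Require Export complex.

Set Implicit Arguments.
Unset Strict Implicit.
Unset Printing Implicit Defensive.

Import Order.TTheory GRing.Theory Num.Theory.
Import numFieldNormedType.Exports.

Local Open Scope classical_set_scope.
Local Open Scope complex_scope.
Local Open Scope ring_scope.

(* ['rV[R]_p] with its Borel sigma-algebra.  The norm, hence [ball], on
   ['rV[R]_p] is the library's sup norm; every notion below that mentions balls
   is unchanged if the Euclidean norm is used instead. *)
Notation borelRV R p := (g_sigma_algebraType (@open 'rV[R]_p)).

(* Every ball contains finitely many points of [A]; this is stronger than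
   discreteness of the subspace topology of [A]. *)
Definition ball_finite (R : realType) (p : nat) (A : set 'rV[R]_p) : Prop :=
  forall (x : 'rV[R]_p) (r : R), finite_set (ball x r `&` A).

Definition relatively_dense (R : realType) (p : nat) (A : set 'rV[R]_p) : Prop :=
  exists l : R, forall x : 'rV[R]_p, ball x l `&` A !=set0.

(* [R[i]^o] carries the topology of the modulus; [Normc.normc] is the modulus
   as an element of [R]. *)
Definition almost_periodic_fun (R : realType) (p : nat)
    (f : 'rV[R]_p -> R[i]) : Prop :=
  continuous (f : 'rV[R]_p -> R[i]^o) /\
  forall eps : R, 0 < eps ->
    relatively_dense
      [set tau : 'rV[R]_p |
        (ereal_sup [set (Normc.normc (f (x + tau) - f x))%:E | x in [set: 'rV[R]_p]]
         < eps%:E)%E].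

(* A locally finite complex Borel measure, given by locally finite positive
   measures as [(re_pos - re_neg) + i (im_pos - im_neg)].  The decomposition is
   not required to be the Jordan one; everything below depends only on the
   resulting complex measure. *)
Record cmeasure (R : realType) (p : nat) := CMeasure {
  re_pos : {measure set (borelRV R p) -> \bar R};
  re_neg : {measure set (borelRV R p) -> \bar R};
  im_pos : {measure set (borelRV R p) -> \bar R};
  im_neg : {measure set (borelRV R p) -> \bar R};
  re_pos_locfin : forall (x : 'rV[R]_p) (r : R), (re_pos (ball x r) < +oo)%E;
  re_neg_locfin : forall (x : 'rV[R]_p) (r : R), (re_neg (ball x r) < +oo)%E;
  im_pos_locfin : forall (x : 'rV[R]_p) (r : R), (im_pos (ball x r) < +oo)%E;
  im_neg_locfin : forall (x : 'rV[R]_p) (r : R), (im_neg (ball x r) < +oo)%E }.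

(* Meaningful on bounded Borel sets only: elsewhere [fine] may collapse an
   infinite value to 0. *)
Definition cvalue (R : realType) (p : nat) (mu : cmeasure R p)
    (B : set 'rV[R]_p) : R[i] :=
  (fine (re_pos mu B) - fine (re_neg mu B)) +i*
  (fine (im_pos mu B) - fine (im_neg mu B)).

Definition cintegral_pos (R : realType) (p : nat)
    (m : {measure set (borelRV R p) -> \bar R}) (f : 'rV[R]_p -> R[i]) : R[i] :=
  Rintegral m setT (fun t : borelRV R p => complex.Re (f t)) +i*
  Rintegral m setT (fun t : borelRV R p => complex.Im (f t)).

Definition cintegral (R : realType) (p : nat) (mu : cmeasure R p)
    (f : 'rV[R]_p -> R[i]) : R[i] :=
  (cintegral_pos (re_pos mu) f - cintegral_pos (re_neg mu) f) +
  'i%C * (cintegral_pos (im_pos mu) f - cintegral_pos (im_neg mu) f).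

Definition compactly_supported (R : realType) (p : nat)
    (f : 'rV[R]_p -> R[i]) : Prop :=
  compact (closure [set x | f x != 0]).

Definition almost_periodic_measure (R : realType) (p : nat)
    (mu : cmeasure R p) : Prop :=
  forall phi : 'rV[R]_p -> R[i], continuous (phi : 'rV[R]_p -> R[i]^o) ->
    compactly_supported phi ->
    almost_periodic_fun (fun x => cintegral mu (fun t => phi (x + t))).

(* [mu = \sum_n a n * \d_(x n)] on bounded Borel sets.  As this is required for
   every such [B], the series converge absolutely.  Finitely many atoms are
   covered by taking [a n = 0] for large [n]. *)
Definition discrete_measure (R : realType) (p : nat) (mu : cmeasure R p) : Prop :=
  exists (x : nat -> 'rV[R]_p) (a : nat -> R[i]),
    forall B : set (borelRV R p), measurable B -> bounded_set (B : set 'rV[R]_p) ->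
      (fun N => \sum_(0 <= n < N) a n * (fine (dirac (x n : borelRV R p) B))%:C
         : R[i]^o) @ \oo --> (cvalue mu B : R[i]^o).

Definition nonzero_measure (R : realType) (p : nat) (mu : cmeasure R p) : Prop :=
  exists B : set (borelRV R p),
    [/\ measurable B, bounded_set (B : set 'rV[R]_p) & cvalue mu B != 0].

Definition cmass (R : realType) (p : nat) (mu : cmeasure R p)
  (x : 'rV[R]_p) : R[i] := cvalue mu [set x].

Definition csupp (R : realType) (p : nat) (mu : cmeasure R p) : set 'rV[R]_p :=
  [set x | cmass mu x != 0].

Definition full_rank_lattice (R : realType) (p : nat) (L : set 'rV[R]_p) : Prop :=
  exists2 A : 'M[R]_p, A \in unitmx &
    L = [set map_mx intr z *m A | z in [set: 'rV[int]_p]].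

Definition translate (R : realType) (p : nat) (L : set 'rV[R]_p)
  (c : 'rV[R]_p) : set 'rV[R]_p := [set y + c | y in L].

(* Main.v *)
(* Write S_j for the support of mu_j.  Almost periodicity makes S_1 and S_2
   relatively dense; hence S_j - S_j is locally finite, since
   x - x' = (x - y) - (x' - y) with y in the other support near x'.  An almost
   period tau of mu_j, tested against a narrow bump, moves every point of S_j to
   within eta of a point of S_j, because the masses are bounded below.  By local
   finiteness of S_j - S_j the displacement is the same for all points, so it is
   an exact period of S_j near tau.  Thus the group T_j of periods of S_j is
   relatively dense.  As T_1 + T_2 is contained in a translate of S_1 - S_2, the
   pigeonhole principle gives every t in T_1 a positive multiple in T_2, so p
   linearly independent vectors of T_1 can be scaled into both groups; the
   lattice they span has bounded fundamental domain, which meets each S_j in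
   finitely many points. *)

Require Import Defs.
From mathcomp Require Import all_boot all_order all_algebra.
From mathcomp Require Import all_classical all_reals all_analysis.
From mathcomp Require Import measurable_realfun lra ring.

Set Implicit Arguments.
Unset Strict Implicit.
Unset Printing Implicit Defensive.

Import Order.TTheory GRing.Theory Num.Theory.
Import numFieldNormedType.Exports.

Local Open Scope classical_set_scope.
Local Open Scope ring_scope.

(** * Locally finite sets and their difference sets *)

Lemma finite_set_pos_lbound (R : realType) (A : set R) :
  finite_set A -> (forall a, A a -> 0 < a) ->
  exists2 g : R, 0 < g & forall a, A a -> g <= a.
Proof.
move=> /finite_seqP[s ->] s0.
have {s0} : forall a, a \in s -> 0 < a by move=> a /s0.
elim: s => [_|b s IH bs0]; first by exists 1.
have [a as_|g g0 gs] := IH; first by apply: bs0; rewrite inE as_ orbT.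
exists (Num.min b g); first by rewrite lt_min g0 bs0// mem_head.
move=> a /=; rewrite inE ge_min => /orP[/eqP->|/gs ->]; first by rewrite lexx.
by rewrite orbT.
Qed.

(** Only finitely many nonzero distances occur between points of [E] in the ball of radius [r + 1],
    so they have a positive lower bound. Capping [g] at 1 keeps [b] in that ball. *)
Lemma ball_finite_gap (R : realType) (p : nat) (E : set 'rV[R]_p) (r : R) :
  ball_finite E -> exists2 g : R, 0 < g &
    forall a b, E a -> E b -> `|a| < r -> `|a - b| < g -> a = b.
Proof.
move=> Efin; pose F := ball (0 : 'rV[R]_p) (r + 1) `&` E.
have Ffin : finite_set F by exact: Efin.
pose N := [set d : R | d != 0] `&` [set `|a - b| | a in F & b in F].
have Nfin : finite_set N by apply: finite_setIr; exact: finite_image2.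
have [|g g0 gN] := finite_set_pos_lbound Nfin.
  by move=> a [/= a0 [u _ [v _ uva]]]; rewrite lt0r a0 -uva normr_ge0.
exists (Num.min g 1); first by rewrite lt_min g0 ltr01.
move=> a b Ea Eb ar; rewrite lt_min => /andP[abg ab1].
have inF c : E c -> `|c| < r + 1 -> F c.
  by move=> Ec cr; split => //; rewrite -ball_normE /= sub0r normrN.
have Fa : F a by apply: inF => //; rewrite (lt_trans ar)// ltrDl ltr01.
have Fb : F b.
  apply: inF => //; rewrite -[b](subKr a) (le_lt_trans (ler_normB _ _))//.
  by rewrite ltrD.
apply/eqP; rewrite -subr_eq0 -normr_eq0; apply/negPn/negP => ab0.
have /gN : N `|a - b| by split => //; exists a => //; exists b.
by rewrite leNgt abg.
Qed.

Definition dense_at (R : realType) (p : nat) (S : set 'rV[R]_p) (l : R) :=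
  forall x, exists2 s, S s & `|x - s| < l.

Lemma dense_at_gt0 (R : realType) (p : nat) (S : set 'rV[R]_p) (l : R) :
  dense_at S l -> 0 < l.
Proof. by move=> /(_ 0)[s _]; apply: le_lt_trans. Qed.

Lemma relatively_denseP (R : realType) (p : nat) (S : set 'rV[R]_p) :
  relatively_dense S <-> exists l : R, dense_at S l.
Proof.
split=> -[l Sl]; exists l => x.
  by have [s [xs Ss]] := Sl x; exists s => //; move: xs; rewrite -ball_normE.
by have [s Ss xs] := Sl x; exists s; split => //; rewrite -ball_normE.
Qed.

Lemma ball_finite_opp (R : realType) (p : nat) (S1 S2 : set 'rV[R]_p) :
  ball_finite [set x - y | x in S1 & y in S2] ->
  ball_finite [set y - x | y in S2 & x in S1].
Proof.
move=> Dfin c r; apply: sub_finite_set (finite_image -%R (Dfin (- c) r)).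
move=> u [cu [y Sy [x Sx yxu]]]; exists (x - y); last by rewrite -yxu opprB.
split; last by exists x => //; exists y.
move: cu; rewrite -!ball_normE /= -yxu.
suff -> : - c - (x - y) = - (c - (y - x)) by rewrite normrN.
by apply/rowP => i; rewrite !mxE; ring.
Qed.

Lemma ball_finite_diff (R : realType) (p : nat) (S1 S2 : set 'rV[R]_p) (l : R) :
  dense_at S2 l -> ball_finite [set x - y | x in S1 & y in S2] ->
  ball_finite [set x - y | x in S1 & y in S1].
Proof.
move=> S2l Dfin c r.
(* Since [x - x'] has norm below [|c| + r] and [x' - y] has norm below [l], both [x - y] and
   [x' - y] fall in this ball. *)
pose F := ball (0 : 'rV[R]_p) (`|c| + r + l) `&` [set x - y | x in S1 & y in S2].
have Ffin : finite_set F by exact: Dfin.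
apply: sub_finite_set (finite_image2 (fun a b => a - b) Ffin Ffin).
move=> u [cu [x Sx [x' Sx' xu]]]; rewrite -{}xu in cu *.
have [y Sy xy] := S2l x'.
have cr' : `|c - (x - x')| < r by move: cu; rewrite -ball_normE.
have r0 : 0 < r by exact: le_lt_trans cr'.
exists (x - y).
  split; last by exists x => //; exists y.
  rewrite -ball_normE /= sub0r normrN.
  have -> : x - y = c - (c - (x - x')) + (x' - y).
    by apply/rowP => i; rewrite !mxE; ring.
  rewrite (le_lt_trans (ler_normD _ _))// ltrD//.
  by rewrite (le_lt_trans (ler_normB _ _))// ltrD2l.
exists (x' - y); last by apply/rowP => i; rewrite !mxE; ring.
split; last by exists x' => //; exists y.
rewrite -ball_normE /= sub0r normrN (lt_le_trans xy)// lerDr.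
by rewrite addr_ge0// ltW.
Qed.

Lemma ball_finite_minuend (R : realType) (p : nat) (S1 S2 : set 'rV[R]_p) :
  S2 !=set0 -> ball_finite [set x - y | x in S1 & y in S2] -> ball_finite S1.
Proof.
move=> [y Sy] Dfin c r.
apply: sub_finite_set (finite_image (+%R^~ y) (Dfin (c - y) r)) => u [cu Su].
exists (u - y); last exact: subrK.
split; last by exists u => //; exists y.
move: cu; rewrite -!ball_normE /=.
suff -> : c - y - (u - y) = c - u by [].
by apply/rowP => i; rewrite !mxE; ring.
Qed.

(** * From almost periods to exact periods *)

(* The displacement is the same for any two points of [S] at distance less than
   [2 l + 1], and such steps connect all of [S]. *)
Lemma exact_translation (R : realType) (p : nat) (S : set 'rV[R]_p)
    (l g : R) (tau : 'rV[R]_p) :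
  dense_at S l ->
  (forall x1 x2 y1 y2, S x1 -> S x2 -> S y1 -> S y2 -> `|x1 - x2| < l *+ 2 + 1 ->
    `|(x1 - x2) - (y1 - y2)| < g -> x1 - x2 = y1 - y2) ->
  (forall x, S x -> exists2 y, S y & `|x + tau - y| < g / 2) ->
  exists2 t, `|t - tau| < g / 2 & forall x, S x -> S (x + t).
Proof.
move=> Sl Sg Stau.
have l0 := dense_at_gt0 Sl.
have [x0 Sx0 _] := Sl 0.
have /choice[u uP] : forall x, exists y, S x -> S y /\ `|x + tau - y| < g / 2.
  by move=> x; have [/Stau[y]|] := pselect (S x); [exists y | exists x].
have step x y : S x -> S y -> `|x - y| < l *+ 2 + 1 -> u x - x = u y - y.
  move=> Sx Sy xy; have [Sux xu] := uP _ Sx; have [Suy yu] := uP _ Sy.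
  have : x - y = u x - u y.
    apply: Sg => //.
    have -> : x - y - (u x - u y) = (x + tau - u x) - (y + tau - u y).
      by apply/rowP => i; rewrite !mxE; ring.
    by rewrite (le_lt_trans (ler_normB _ _))// [ltRHS](splitr g) ltrD.
  move/rowP => xyE; apply/rowP => i; have := xyE i; rewrite !mxE; lra.
have const n : forall x, S x -> `|x - x0| < n%:R -> u x - x = u x0 - x0.
  elim: n => [x _|n IH x Sx xn]; first by rewrite ltNge normr_ge0.
  have [xl|lx] := ltP `|x - x0| (l *+ 2 + 1); first exact: step.
  have xx0 : 0 < `|x - x0|.
    by apply: lt_le_trans lx; rewrite addr_gt0// mulrn_wgt0.
  (* A step of length [l + 1] from [x] towards [x0]: a point [s] of [S] within [l] of its end is at
     distance less than [2 l + 1] from [x] and closer to [x0] than [x] by more than 1, so the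
     induction on [n] applies to [s]. *)
  pose c := (l + 1) / `|x - x0|.
  have c1 : c <= 1.
    rewrite /c ler_pdivrMr// mul1r; apply: le_trans lx.
    by rewrite lerD2r mulr2n lerDl ltW.
  have c0 : 0 <= c by rewrite /c divr_ge0// addr_ge0// ltW.
  have cE : c * `|x - x0| = l + 1 by rewrite /c divfK// gt_eqF.
  have [s Ss ws] := Sl (x - c *: (x - x0)).
  rewrite (step x s)//.
    apply: IH => //.
    have -> : s - x0 = (1 - c) *: (x - x0) - ((x - c *: (x - x0)) - s).
      by apply/rowP => i; rewrite !mxE; ring.
    rewrite (le_lt_trans (ler_normB _ _))// normrZ ger0_norm ?subr_ge0//.
    rewrite mulrBl mul1r cE; move: xn ws; rewrite -natr1; lra.
  have -> : x - s = c *: (x - x0) + (x - c *: (x - x0) - s).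
    by apply/rowP => i; rewrite !mxE; ring.
  rewrite (le_lt_trans (ler_normD _ _))// normrZ ger0_norm// cE.
  by rewrite mulr2n; move: ws; lra.
exists (u x0 - x0).
  have [_] := uP _ Sx0.
  by rewrite -normrN opprB opprD addrA.
move=> x Sx; rewrite -(const (Num.bound `|x - x0|) x)//; last first.
  exact: archi_boundP.
by rewrite addrC subrK; case: (uP _ Sx).
Qed.

(** Both signs are required, so that translation by [t] maps [S] onto itself and the periods form a
    group. *)
Definition periods (R : realType) (p : nat) (S : set 'rV[R]_p) : set 'rV[R]_p :=
  [set t | forall x, S x -> S (x + t) /\ S (x - t)].

Lemma periods0 (R : realType) (p : nat) (S : set 'rV[R]_p) : periods S 0.
Proof. by move=> x Sx; rewrite subr0 addr0. Qed.

Lemma periodsN (R : realType) (p : nat) (S : set 'rV[R]_p) t :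
  periods S t -> periods S (- t).
Proof. by move=> St x /St[]; rewrite opprK. Qed.

Lemma periodsD (R : realType) (p : nat) (S : set 'rV[R]_p) s t :
  periods S s -> periods S t -> periods S (s + t).
Proof.
move=> Ss St x Sx; rewrite opprD !addrA.
by split; [apply St; apply Ss | apply St; apply Ss].
Qed.

Lemma periodsMn (R : realType) (p : nat) (S : set 'rV[R]_p) t n :
  periods S t -> periods S (t *+ n).
Proof.
move=> St; elim: n => [|n IH]; first by rewrite mulr0n; exact: periods0.
by rewrite mulrS; exact: periodsD.
Qed.

Lemma periodsMz (R : realType) (p : nat) (S : set 'rV[R]_p) t (z : int) :
  periods S t -> periods S (t *~ z).
Proof.
by case: z => n St; [rewrite -pmulrn|rewrite NegzE -nmulrn; apply: periodsN];
  exact: periodsMn.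
Qed.

Lemma dense_periods (R : realType) (p : nat) (S : set 'rV[R]_p) (l : R) :
  dense_at S l -> ball_finite [set x - y | x in S & y in S] ->
  (forall eta, 0 < eta -> relatively_dense
    [set tau | forall x, S x -> (exists2 y, S y & `|x + tau - y| < eta) /\
                               (exists2 y, S y & `|x - tau - y| < eta)]) ->
  exists l', dense_at (periods S) l'.
Proof.
move=> Sl SS Stau.
have l0 := dense_at_gt0 Sl.
(* The radius is the one [exact_translation] asks for; the tolerance [g / 2] below makes two
   approximation errors add up to less than [g]. *)
have [g g0 Sg] := ball_finite_gap (l *+ 2 + 1) SS.
have {}Sg x1 x2 y1 y2 : S x1 -> S x2 -> S y1 -> S y2 ->
    `|x1 - x2| < l *+ 2 + 1 -> `|(x1 - x2) - (y1 - y2)| < g -> x1 - x2 = y1 - y2.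
  by move=> *; apply: Sg => //; [exists x1 => //; exists x2|exists y1 => //; exists y2].
have g20 : 0 < g / 2 by rewrite divr_gt0.
have /relatively_denseP[l' tl'] := Stau _ g20.
exists (l' + g / 2) => x.
have [tau tauP xtau] := tl' x.
have [|t tt tS] := @exact_translation _ _ _ _ _ tau Sl Sg; first by move=> y /tauP[].
have [|t' tt' tS'] := @exact_translation _ _ _ _ _ (- tau) Sl Sg.
  by move=> y /tauP[].
exists t; last first.
  have -> : x - t = (x - tau) - (t - tau) by rewrite opprB addrA subrK.
  by rewrite (le_lt_trans (ler_normB _ _))// ltrD.
(* So far [t] and [t'] only map [S] into itself. The point [x0 + t + t'] of [S] lies within [g] of
   [x0], so the gap, applied to the differences [x0 - x0] and [x0 + t + t' - x0], forces
   [t + t' = 0]. *)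
have t't : t' = - t.
  have [x0 Sx0 _] := Sl 0.
  have /rowP x0tt' : x0 - x0 = x0 + t + t' - x0.
    apply: Sg => //; first by apply: tS'; exact: tS.
      by rewrite subrr normr0 addr_gt0// mulrn_wgt0.
    have -> : x0 - x0 - (x0 + t + t' - x0) = - ((t - tau) + (t' - - tau)).
      by apply/rowP => i; rewrite !mxE; ring.
    by rewrite normrN (le_lt_trans (ler_normD _ _))// [ltRHS](splitr g) ltrD.
  by apply/rowP => i; have := x0tt' i; rewrite !mxE; lra.
by move=> y Sy; split; [exact: tS|rewrite -t't; exact: tS'].
Qed.

(** * Common periods and the lattice they span *)

Lemma period_multiple (R : realType) (p : nat) (S1 S2 : set 'rV[R]_p) (l : R)
    (t : 'rV[R]_p) :
  S1 !=set0 -> S2 !=set0 -> ball_finite [set x - y | x in S1 & y in S2] ->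
  dense_at (periods S2) l -> periods S1 t ->
  exists2 n, (0 < n)%N & periods S2 (t *+ n).
Proof.
move=> [x0 Sx0] [y0 Sy0] Dfin T2l T1t.
have /choice[s sP] : forall k : nat, exists s, periods S2 s /\ `|t *+ k - s| < l.
  by move=> k; have [s ? ?] := T2l (t *+ k); exists s.
(* Each [f k] is a difference of a point of [S1] and a point of [S2], within [l] of [x0 - y0]. Only
   finitely many values occur, so [f i = f j] for some [i < j], and then [t *+ (j - i) = s j - s i]
   is a period of [S2]. *)
pose f k := (x0 + t *+ k) - (y0 + s k).
have fD k : (ball (x0 - y0) l `&` [set x - y | x in S1 & y in S2]) (f k).
  have [sk skl] := sP k; split.
    rewrite -ball_normE /= /f -normrN.
    suff -> : - (x0 - y0 - (x0 + t *+ k - (y0 + s k))) = t *+ k - s k by [].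
    by apply/rowP => i; rewrite !mxE; ring.
  exists (x0 + t *+ k); first by apply (periodsMn k T1t).
  by exists (y0 + s k) => //; apply sk.
have [inj|] := pselect (injective f).
  exfalso; apply: infinite_nat.
  have -> : [set: nat] = f @^-1` (ball (x0 - y0) l `&` [set x - y | x in S1 & y in S2]).
    by apply/seteqP; split => // k _; exact: fD.
  by apply: finite_preimage => //; exact: in2W.
move=> /existsNP[i /existsNP[j /not_implyP[fij ij]]].
wlog ltij : i j fij ij / (i < j)%N.
  move=> wl; case: (ltngtP i j) => // [|ji]; first exact: wl.
  by apply: (wl j i) => // /esym.
exists (j - i)%N; first by rewrite subn_gt0.
have -> : t *+ (j - i) = s j - s i.
  rewrite mulrnBr 1?ltnW//; move: fij => /rowP fij; apply/rowP => k.
  by have := fij k; rewrite /f !mxE; lra.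
by apply: periodsD; [|apply: periodsN]; case: (sP i); case: (sP j).
Qed.

Lemma coord_le_norm (R : realType) (p : nat) (v : 'rV[R]_p) j : `|v 0 j| <= `|v|.
Proof.
rewrite [leRHS]/Num.norm /= mx_normrE; apply/bigmax_geP; right => /=.
by exists (0, j).
Qed.

Lemma norm_mulmx_le (R : realType) (p : nat) (v : 'rV[R]_p) (A : 'M[R]_p) :
  `|v *m A| <= \sum_i `|v 0 i| * `|row i A|.
Proof.
rewrite mulmx_sum_row (le_trans (ler_norm_sum _ _ _))//.
by apply: ler_sum => i _; rewrite normrZ.
Qed.

(* Elements of [T] close to the vectors [K e_i], with [K] large, form a strictly
   diagonally dominant matrix. *)
Lemma dense_at_unitmx (R : realType) (p : nat) (T : set 'rV[R]_p) (l : R) :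
  dense_at T l -> exists2 A : 'M[R]_p, A \in unitmx & forall i, T (row i A).
Proof.
move=> Tl; have l0 := dense_at_gt0 Tl.
pose K := l *+ p + 1.
have K0 : 0 < K by rewrite /K ltr_wpDl// mulrn_wge0// ltW.
have /choice[t tP] : forall i : 'I_p, exists t, T t /\ `|K *: delta_mx 0 i - t| < l.
  by move=> i; have [t ? ?] := Tl (K *: delta_mx 0 i); exists t.
exists (\matrix_i t i); last by move=> i; rewrite rowK; case: (tP i).
rewrite unitmxE unitfE; apply/det0P => -[v v0 vA].
(* Let [A] be the matrix. A vector [v] with [v A = 0] satisfies [v (K I - A) = K v], while each of
   the [p] rows of [K I - A] has norm below [l]; this contradicts [K > l p]. *)
have : K * `|v| <= (l *+ p) * `|v|.
  have -> : K * `|v| = `|v *m (K%:M - \matrix_i t i)|.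
    by rewrite mulmxBr vA subr0 mul_mx_scalar normrZ gtr0_norm.
  rewrite (le_trans (norm_mulmx_le _ _))//.
  apply: (@le_trans _ _ (\sum_(i < p) `|v| * l)); last first.
    by rewrite sumr_const card_ord -mulrnAr mulrC.
  apply: ler_sum => i _; rewrite ler_pM// ?coord_le_norm//.
  rewrite raddfB/= rowK -scalemx1 linearZ/= row1.
  by apply: ltW; case: (tP i).
rewrite leNgt; move/negP; apply.
by rewrite ltr_pM2r ?normr_gt0// ltrDl ltr01.
Qed.

(** Removing the integer parts of the coordinates in the basis of rows of [A] brings every point of
    [S] into a fixed ball, which contains finitely many points of [S]. These serve as the [c k];
    several may represent the same coset. *)
Lemma lattice_cosets (R : realType) (p : nat) (S : set 'rV[R]_p) (A : 'M[R]_p) :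
  A \in unitmx -> S !=set0 -> ball_finite S ->
  (forall (z : 'rV[int]_p) x, S x -> S (map_mx intr z *m A + x)) ->
  exists (r : nat) (c : 'I_r -> 'rV[R]_p), (0 < r)%N /\
    S = \bigcup_(k in [set: 'I_r])
      translate [set map_mx intr z *m A | z in [set: 'rV[int]_p]] (c k).
Proof.
move=> Au [x0 Sx0] Sfin SA.
pose M := \sum_i `|row i A|.
have /finite_seqP[s sE] := Sfin 0 (M + 1).
have red x : S x -> exists2 z : 'rV[int]_p, x - map_mx intr z *m A \in s & True.
  move=> Sx; have [w wE] : exists w, w = x *m invmx A by exists (x *m invmx A).
  pose z : 'rV[int]_p := \row_i Num.floor (w 0 i).
  exists z => //; suff : [set` s] (x - map_mx intr z *m A) by [].
  rewrite -sE; split; last first.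
    rewrite addrC -mulNmx (_ : - _ = map_mx intr (- z)); first exact: SA.
    by apply/rowP => i; rewrite !mxE rmorphN.
  rewrite -ball_normE /= sub0r normrN.
  have -> : x - map_mx intr z *m A = (w - map_mx intr z) *m A.
    by rewrite mulmxBl wE mulmxKV.
  rewrite (le_lt_trans (norm_mulmx_le _ _))//.
  apply: (@le_lt_trans _ _ M); last by rewrite ltrDl ltr01.
  apply: ler_sum => i _; rewrite ler_piMl// !mxE.
  have /andP[fw wf] := floor_itv (w 0 i).
  by rewrite ger0_norm ?subr_ge0// lerBlDl ltW// -[1]/(1%:~R) -intrD.
exists (size s), (fun k => tnth (in_tuple s) k); split.
  by have [z] := red _ Sx0; case: (s).
apply/seteqP; split => [x Sx|x [k _ [_ [z _ <-] <-]]].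
  have [z xz _] := red _ Sx.
  have /tnthP[k kE] : x - map_mx intr z *m A \in in_tuple s by [].
  exists k => //; exists (map_mx intr z *m A); first by exists z.
  by rewrite -kE addrC subrK.
apply: SA; have : [set` s] (tnth (in_tuple s) k) by exact: mem_tnth.
by rewrite -sE => -[].
Qed.

Lemma periods_lattice (R : realType) (p : nat) (S : set 'rV[R]_p) (A : 'M[R]_p) :
  (forall i, periods S (row i A)) ->
  forall (z : 'rV[int]_p) x, S x -> S (map_mx intr z *m A + x).
Proof.
move=> SA z x Sx; rewrite addrC.
suff /(_ _ Sx)[] : periods S (map_mx intr z *m A) by [].
rewrite mulmx_sum_row; elim/big_ind: _ => [|u v|i _].
- exact: periods0.
- exact: periodsD.
by rewrite mxE scaler_int; exact: periodsMz.
Qed.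

Lemma common_lattice (R : realType) (p : nat) (S1 S2 : set 'rV[R]_p) (l1 l2 : R) :
  S1 !=set0 -> S2 !=set0 -> ball_finite [set x - y | x in S1 & y in S2] ->
  dense_at (periods S1) l1 -> dense_at (periods S2) l2 ->
  exists (L : set 'rV[R]_p) (r1 r2 : nat)
         (c1 : 'I_r1 -> 'rV[R]_p) (c2 : 'I_r2 -> 'rV[R]_p),
    [/\ full_rank_lattice L, (0 < r1)%N, (0 < r2)%N,
        S1 = \bigcup_(k in [set: 'I_r1]) translate L (c1 k) &
        S2 = \bigcup_(k in [set: 'I_r2]) translate L (c2 k)].
Proof.
move=> S1n S2n Dfin T1 T2.
have [B Bu T1B] := dense_at_unitmx T1.
have /choice[n nP] : forall i, exists n, (0 < n)%N /\ periods S2 (row i B *+ n).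
  by move=> i; have [n ? ?] := period_multiple S1n S2n Dfin T2 (T1B i); exists n.
(* Row [i] of [A] is [n i] times row [i] of [B]: still a period of [S1], and now also one of [S2].
   Positivity of the [n i] keeps [A] invertible. *)
pose A := diag_mx (\row_i (n i)%:R) *m B.
have rowA i : row i A = row i B *+ n i.
  by apply/rowP => j; rewrite /A mul_diag_mx mulmxnE !mxE mulr_natl.
have Au : A \in unitmx.
  rewrite unitmx_mul Bu andbT unitmxE det_diag unitfE prodf_seq_neq0.
  by apply/allP => i _; rewrite mxE pnatr_eq0 -lt0n; case: (nP i).
have S1A : forall i, periods S1 (row i A) by move=> i; rewrite rowA; exact: periodsMn.
have S2A : forall i, periods S2 (row i A) by move=> i; rewrite rowA; case: (nP i).
have S1f := ball_finite_minuend S2n Dfin.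
have S2f := ball_finite_minuend S1n (ball_finite_opp Dfin).
have [r1 [c1 [r1n S1E]]] := lattice_cosets Au S1n S1f (periods_lattice S1A).
have [r2 [c2 [r2n S2E]]] := lattice_cosets Au S2n S2f (periods_lattice S2A).
by exists [set map_mx intr z *m A | z in [set: 'rV[int]_p]], r1, r2, c1, c2;
  split => //; exists A.
Qed.

(** * Borel sets and discrete measures off their support *)

Lemma borelRV_open (R : realType) (p : nat) (U : set 'rV[R]_p) :
  open U -> measurable (U : set (borelRV R p)).
Proof. exact: sub_sigma_algebra. Qed.

Lemma borelRV_set1 (R : realType) (p : nat) (z : 'rV[R]_p) :
  measurable ([set z] : set (borelRV R p)).
Proof.
rewrite -[X in measurable X](@setCK (borelRV R p)); apply: measurableC.
apply: borelRV_open; rewrite openC.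
apply: accessible_closed_set1; apply: hausdorff_accessible.
exact: norm_hausdorff.
Qed.

Lemma borelRV_continuous (R : realType) (p : nat) (f : 'rV[R]_p -> R) D :
  continuous f -> measurable D -> measurable_fun (D : set (borelRV R p)) f.
Proof.
move=> cf mD; apply: (measurability _ (RGenOInfty.measurableE R)).
move=> _ [_ [a ->] <-]; apply: measurableI => //.
apply: borelRV_open; apply: open_comp => [x _|]; first exact: cf.
by rewrite set_itvoy; exact: open_gt.
Qed.

Lemma measure_eq_countable (R : realType) (p : nat)
    (m m' : {measure set (borelRV R p) -> \bar R}) (x : nat -> 'rV[R]_p)
    (B : set (borelRV R p)) :
  measurable B -> (forall z, B z -> m [set z] = m' [set z]) ->
  m (B `&` range x) = m' (B `&` range x).
Proof.
move=> mB mm'.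
(* The sequence [x] may repeat points; after [seqDU] each piece is empty or a singleton, and
   countable additivity applies. *)
pose F k : set (borelRV R p) := B `&` [set x k].
have -> : B `&` range x = \bigcup_k seqDU F k.
  rewrite -seqDU_bigcup_eq /F -setI_bigcupr; congr (_ `&` _).
  by apply/seteqP; split => [_ [k _ <-]|_ [k _ ->]]; exists k.
have mF k : measurable (F k).
  by apply: measurableI => //; exact: borelRV_set1.
have mS k : measurable (seqDU F k).
  apply: measurableD => //; apply: bigsetU_measurable => *; exact: mF.
rewrite !measure_bigcup//; try exact: trivIset_seqDU.
apply: eq_eseriesr => k _.
have [[z Sz]|] := pselect (seqDU F k !=set0); last first.
  by move=> /set0P/negP; rewrite negbK => /eqP ->; rewrite !measure0.
have Bz : B z by case: Sz => -[].
suff -> : seqDU F k = [set z] by exact: mm'.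
apply/seteqP; split => [y [[_ ->] _]|y ->//].
by case: Sz => -[_ ->].
Qed.

Lemma locfin_bounded (R : realType) (p : nat)
    (m : {measure set (borelRV R p) -> \bar R}) (B : set (borelRV R p)) :
  (forall (x : 'rV[R]_p) (r : R), (m (ball x r) < +oo)%E) ->
  measurable B -> bounded_set (B : set 'rV[R]_p) -> m B \is a fin_num.
Proof.
move=> mfin mB [M [_ BM]]; rewrite ge0_fin_numE ?measure_ge0//.
(* [bounded_set] gives bounds only by constants above [M], hence [M + 1]; the open ball then has
   radius [M + 2]. *)
apply: le_lt_trans (mfin 0 (M + 2)); apply: le_measure; rewrite ?inE//.
  by apply: borelRV_open; exact: ball_open.
move=> x Bx; rewrite -ball_normE /= sub0r normrN.
by apply: (@le_lt_trans _ _ (M + 1)); [apply: BM => //|]; lra.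
Qed.

(** The decomposition need not be the Jordan one, so off the support the parts may cancel without
    vanishing. On [range x] countable additivity reduces the claim to points, whose masses are 0;
    outside [range x] every term of the series is 0. *)
Lemma discrete_offsupp (R : realType) (p : nat) (mu : cmeasure R p)
    (B : set (borelRV R p)) :
  discrete_measure mu -> measurable B -> bounded_set (B : set 'rV[R]_p) ->
  B `&` csupp mu = set0 ->
  re_pos mu B = re_neg mu B /\ im_pos mu B = im_neg mu B.
Proof.
move=> [x [a xa]] mB bB BS.
have bsub C : C `<=` B -> bounded_set (C : set 'rV[R]_p).
  move=> CB; case: bB => M [Mr BM]; exists M; split => // k /BM BMk y /CB.
  exact: BMk.
(* Local finiteness makes all four values finite, so equal [fine] values mean equal values. *)
have cval0 (C : set (borelRV R p)) : measurable C -> bounded_set (C : set 'rV[R]_p) -> cvalue mu C = 0 ->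
    re_pos mu C = re_neg mu C /\ im_pos mu C = im_neg mu C.
  move=> mC bC [/subr0_eq rC /subr0_eq iC].
  split.
    rewrite -(fineK (locfin_bounded (@re_pos_locfin _ _ mu) mC bC)) rC fineK//.
    exact: locfin_bounded (@re_neg_locfin _ _ mu) mC bC.
  rewrite -(fineK (locfin_bounded (@im_pos_locfin _ _ mu) mC bC)) iC fineK//.
  exact: locfin_bounded (@im_neg_locfin _ _ mu) mC bC.
have pt z : B z -> re_pos mu [set z] = re_neg mu [set z] /\
                   im_pos mu [set z] = im_neg mu [set z].
  move=> Bz; apply: cval0; [exact: borelRV_set1|by apply: bsub => y ->|].
  apply/eqP/negPn/negP => z0; suff : (B `&` csupp mu) z by rewrite BS.
  by split.
have mX : measurable (range x : set (borelRV R p)).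
  rewrite (_ : range x = \bigcup_k [set x k]).
    by apply: bigcupT_measurable => k; exact: borelRV_set1.
  by apply/seteqP; split => [_ [k _ <-]|_ [k _ ->]]; exists k.
have mBX : measurable (B `\` range x) by exact: measurableD.
have bBX : bounded_set (B `\` range x : set 'rV[R]_p).
  by apply: bsub; exact: subDsetl.
have [rBX iBX] : re_pos mu (B `\` range x) = re_neg mu (B `\` range x) /\
    im_pos mu (B `\` range x) = im_neg mu (B `\` range x).
  apply: cval0 => //.
  have := xa _ mBX bBX.
  rewrite (_ : (fun N => _) = cst 0).
    by move=> /(@norm_cvg_unique _ R[i]^o _ _ _ _ (cvg_cst _)) <-.
  apply/funext => N; rewrite big1// => n _.
  rewrite diracE memNset ?mulr0// => -[_]; apply.
  by exists n.
have split_m (m : {measure set (borelRV R p) -> \bar R}) :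
    m B = (m (B `&` range x) + m (B `\` range x))%E.
  rewrite -measureU//; first by rewrite setUIDK.
    exact: measurableI.
  by rewrite setDE setIACA setICr setI0.
rewrite !(split_m (re_pos mu)) !(split_m (im_pos mu)) (split_m (re_neg mu))
  (split_m (im_neg mu)) rBX iBX.
by rewrite (@measure_eq_countable _ _ (re_pos mu) (re_neg mu))//
  ?(@measure_eq_countable _ _ (im_pos mu) (im_neg mu))// => z /pt[].
Qed.

(** * Tent-shaped test functions *)

Definition bump (R : realType) (p : nat) (d : R) (t : 'rV[R]_p) : R :=
  Num.max 0 (d - `|t|).

Lemma bump_ge0 (R : realType) (p : nat) (d : R) (t : 'rV[R]_p) : 0 <= bump d t.
Proof. by rewrite le_max lexx. Qed.

Lemma bump_le (R : realType) (p : nat) (d : R) (t : 'rV[R]_p) :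
  0 <= d -> bump d t <= d.
Proof. by move=> d0; rewrite ge_max d0 lerBlDr lerDl normr_ge0. Qed.

Lemma bump_out (R : realType) (p : nat) (d : R) (t : 'rV[R]_p) :
  d <= `|t| -> bump d t = 0.
Proof. by move=> dt; rewrite /bump max_l// subr_le0. Qed.

Lemma bump_at0 (R : realType) (p : nat) (d : R) :
  0 <= d -> bump d (0 : 'rV[R]_p) = d.
Proof. by move=> d0; rewrite /bump normr0 subr0 max_r. Qed.

Lemma bump_continuous (R : realType) (p : nat) (d : R) :
  continuous (@bump R p d).
Proof.
move=> t; apply: (@continuous_max R _ (fun=> 0) (fun u => d - `|u|)).
  exact: cst_continuous.
apply: (@continuousB R R^o _ (fun=> d) (fun u => `|u|)).
  exact: cst_continuous.
exact: norm_continuous.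
Qed.

Lemma real_complex_continuous (R : realType) (p : nat) (f : 'rV[R]_p -> R) :
  continuous f -> continuous ((fun t => (f t)%:C%C) : 'rV[R]_p -> R[i]^o).
Proof.
move=> cf t.
apply: (proj2 (@cvgrPdist_lt _ R[i]^o _ _ (nbhs_filter t) _ _)) => e e0.
(* Closeness in [R[i]^o] is tested by a positive complex [e], and positivity forces [e] to be
   real. *)
have eE : e = (complex.Re e)%:C%C.
  by move: e0; rewrite lt_def => /andP[_]; case: e => a b; rewrite lecE/= => /andP[/eqP ->].
have er0 : 0 < complex.Re e by move: e0; rewrite {1}eE ltcR.
have /cvgrPdist_lt/(_ _ er0) := cf t.
apply: filterS => u fu.
by rewrite eE -rmorphB /= normc_def /= expr0n /= addr0 sqrtr_sqr ltcR.
Qed.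

Lemma bump_compact (R : realType) (p : nat) (d : R) :
  compactly_supported (fun t : 'rV[R]_p => (bump d t)%:C%C).
Proof.
apply: bounded_closed_compact; last exact: closed_closure.
exists d; split => [|M dM t]; first exact: num_real.
have : closed [set t : 'rV[R]_p | `|t| <= d].
  apply: (@closed_comp _ _ (fun t : 'rV[R]_p => `|t|) [set x : R | x <= d]).
    by move=> t' _; exact: norm_continuous.
  exact: closed_le.
move=> /closure_id ct tS; rewrite /= (le_trans _ (ltW dM))//.
suff : [set t : 'rV[R]_p | `|t| <= d] t by [].
rewrite ct; move: t tS; apply: closure_subset => t /=.
by apply: contraNT; rewrite -ltNge => /ltW/bump_out ->.
Qed.

(** * Integrating a bump against a discrete measure *)

Section one_atom.
Variables (R : realType) (p : nat) (d : R) (x z : 'rV[R]_p).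
Hypothesis d0 : 0 < d.
(** Off this set the translated bump [f] vanishes, except possibly at [z]. If [z] lies outside the
    ball, then [bump d (x + z) = 0]. *)
Let B : set (borelRV R p) := ball (- x) d `\ z.
Let f : borelRV R p -> R := fun t => bump d (x + t).

Let mball : measurable (ball (- x) d : set (borelRV R p)).
Proof. by apply: borelRV_open; exact: ball_open. Qed.

Let mB : measurable B.
Proof. by apply: measurableD => //; exact: borelRV_set1. Qed.

Lemma bump_measurable (D : set (borelRV R p)) :
  measurable D -> measurable_fun D (EFin \o f).
Proof.
move=> mD; apply/measurable_EFinP; apply: borelRV_continuous => // t.
apply: (@continuous_comp _ _ _ (fun u : 'rV[R]_p => x + u) (@bump R p d)).
  apply: (@continuousD R 'rV[R]_p _ (fun=> x) id); last exact: cvg_id.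
  exact: cst_continuous.
exact: bump_continuous.
Qed.

Lemma integral_bump_fin (m : {measure set (borelRV R p) -> \bar R}) :
  (forall (y : 'rV[R]_p) (r : R), (m (ball y r) < +oo)%E) ->
  (\int[m]_(t in B) (f t)%:E)%E \is a fin_num.
Proof.
move=> mfin; rewrite ge0_fin_numE; last first.
  by apply: integral_ge0 => t _; rewrite lee_fin bump_ge0.
apply: (@le_lt_trans _ _ (\int[m]_(t in B) (cst d%:E t))%E).
  apply: ge0_le_integral => //.
  - by move=> t _; rewrite lee_fin bump_ge0.
  - exact: bump_measurable.
  - by move=> t _; rewrite lee_fin bump_le// ltW.
rewrite integral_cst//; apply: lte_mul_pinfty; rewrite ?lee_fin ?ltW//.
apply: le_lt_trans (mfin (- x) d); apply: le_measure; rewrite ?inE//.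
exact: subDsetl.
Qed.

(** The contribution of [z] is split off, because the rest will cancel between positive and negative
    parts. Finiteness of both terms lets [fine] distribute over the sum. *)
Lemma Rintegral_bump (m : {measure set (borelRV R p) -> \bar R}) :
  (forall (y : 'rV[R]_p) (r : R), (m (ball y r) < +oo)%E) ->
  Rintegral m setT f =
  fine (\int[m]_(t in B) (f t)%:E)%E + bump d (x + z) * fine (m [set z]).
Proof.
move=> mfin; rewrite /Rintegral.
have -> : (\int[m]_t (f t)%:E = \int[m]_(t in B `|` [set z]) (f t)%:E)%E.
  rewrite [RHS]integral_mkcond; apply: eq_integral => t _.
  rewrite patchE; case: ifPn => //; rewrite notin_setE => Bt.
  congr EFin; apply: bump_out; rewrite leNgt; apply/negP => xt; apply: Bt.
  have [->|tz] := eqVneq t z; [by right|left; split; last exact/eqP].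
  by rewrite -ball_normE /= -normrN opprB opprK addrC.
have mz := @borelRV_set1 R p z.
rewrite ge0_integral_setU//.
- have -> : (\int[m]_(t in [set z]) (f t)%:E = (f z)%:E * m [set z])%E.
    rewrite -integral_cst//; apply: eq_integral => t.
    by rewrite inE => ->.
  have mzfin : m [set z] \is a fin_num.
    apply: locfin_bounded => //; exists `|z|; split; first exact: num_real.
    by move=> M zM _ ->; exact: ltW.
  by rewrite -(fineK mzfin) -EFinM fineD// integral_bump_fin.
- by apply: bump_measurable; exact: measurableU.
- by move=> t _; rewrite lee_fin bump_ge0.
- by apply/disj_setPS => t [[_ tz] tz0]; exact: (tz tz0).
Qed.

End one_atom.

(** The ball punctured at [z] contains no support point, so positive and negative parts coincide on
    its measurable subsets and their integrals cancel; only the atom at [z] survives. *)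
Lemma cintegral_bump (R : realType) (p : nat) (mu : cmeasure R p) (d : R)
    (x z : 'rV[R]_p) :
  0 < d -> discrete_measure mu -> ball (- x) d `&` csupp mu `<=` [set z] ->
  cintegral mu (fun t => (bump d (x + t))%:C%C) =
    (bump d (x + z))%:C%C * cmass mu z.
Proof.
move=> d0 dmu Sz; rewrite /cintegral /cintegral_pos /=.
have mball : measurable (ball (- x) d : set (borelRV R p)).
  by apply: borelRV_open; exact: ball_open.
have bball A : A `<=` ball (- x) d -> bounded_set (A : set 'rV[R]_p).
  move=> AB; exists (`|x| + d); split=> [|M xM t /AB]; first exact: num_real.
  rewrite -ball_normE /= -opprD normrN => xt; apply: le_trans (ltW xM).
  have -> : t = (x + t) - x by rewrite addrAC subrr add0r.
  by rewrite (le_trans (ler_normB _ _))// addrC lerD2l ltW.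
have offz (A : set (borelRV R p)) : measurable A -> A `<=` ball (- x) d `\ z ->
    re_pos mu A = re_neg mu A /\ im_pos mu A = im_neg mu A.
  move=> mA AB; apply: discrete_offsupp => //.
    by apply: bball => t /AB[].
  by apply/seteqP; split => // t [/AB[xt tz] St]; apply: tz; exact: Sz.
have reE := eq_measure_integral (re_neg mu) (fun A mA AB => (offz A mA AB).1).
have imE := eq_measure_integral (im_neg mu) (fun A mA AB => (offz A mA AB).2).
have R0 (m : {measure set (borelRV R p) -> \bar R}) :
    Rintegral m setT (fun t : borelRV R p => 0) = 0.
  by rewrite /Rintegral integral0.
rewrite !R0.
rewrite (Rintegral_bump x z d0 (@re_pos_locfin _ _ mu)).
rewrite (Rintegral_bump x z d0 (@re_neg_locfin _ _ mu)).
rewrite (Rintegral_bump x z d0 (@im_pos_locfin _ _ mu)).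
rewrite (Rintegral_bump x z d0 (@im_neg_locfin _ _ mu)).
rewrite reE imE /cmass /cvalue.
by apply/eqP; rewrite eq_complex /=; apply/andP; split; apply/eqP; ring.
Qed.

Lemma cintegral_bump_supp (R : realType) (p : nat) (mu : cmeasure R p) (d : R)
    (x : 'rV[R]_p) :
  0 < d -> discrete_measure mu ->
  cintegral mu (fun t => (bump d (x + t))%:C%C) != 0 ->
  exists2 y, csupp mu y & `|- x - y| < d.
Proof.
move=> d0 dmu; apply: contraNP => noS.
(* If no support point lies in the ball, the centre [- x] can be taken as the isolated point, and
   its mass is 0. *)
rewrite (@cintegral_bump _ _ _ _ _ (- x))//.
  suff -> : cmass mu (- x) = 0 by rewrite mulr0.
  apply/eqP/negPn/negP => Sx; apply: noS; exists (- x) => //.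
  by rewrite subrr normr0.
move=> y [xy Sy]; exfalso; apply: noS; exists y => //.
by move: xy; rewrite -ball_normE.
Qed.

(** * Supports of almost periodic measures *)

Lemma csupp_nonempty (R : realType) (p : nat) (mu : cmeasure R p) :
  nonzero_measure mu -> discrete_measure mu -> csupp mu !=set0.
Proof.
move=> [B [mB bB B0]] dmu; apply/set0P; apply: contra_neq B0 => S0.
have [|r i] := discrete_offsupp dmu mB bB; first by rewrite S0 setI0.
by rewrite /cvalue r i !subrr.
Qed.

Lemma bump_almost_periods (R : realType) (p : nat) (mu : cmeasure R p) (d eps : R) :
  almost_periodic_measure mu -> 0 < eps ->
  relatively_dense [set tau | forall x,
    Normc.normc (cintegral mu (fun t => (bump d (x + tau + t))%:C%C) -
                 cintegral mu (fun t => (bump d (x + t))%:C%C)) < eps].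
Proof.
move=> apmu e0.
have [|_ /(_ _ e0)[l lP]] := apmu (fun t => (bump d t)%:C%C) _ (@bump_compact _ _ d).
  by apply: real_complex_continuous; exact: bump_continuous.
exists l => x; have [tau [xtau tauP]] := lP x.
exists tau; split => // y; rewrite -lte_fin; apply: le_lt_trans tauP.
by apply: ereal_sup_ubound; exists y.
Qed.

Lemma normc_realM (R : realType) (r : R) (c : R[i]) :
  Normc.normc (r%:C%C * c) = `|r| * Normc.normc c.
Proof. by rewrite Normc.normcM /= expr0n /= addr0 sqrtr_sqr. Qed.

(* A bump of radius [d] isolating the atom at [z] integrates to [d * mass z], so
   an almost period that changes the integral by less keeps it nonzero. *)
Lemma almost_period_hits (R : realType) (p : nat) (mu : cmeasure R p) (d c : R)
    (z tau : 'rV[R]_p) :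
  0 < d -> discrete_measure mu -> ball z d `&` csupp mu `<=` [set z] ->
  c <= Normc.normc (cmass mu z) ->
  (forall x,
    Normc.normc (cintegral mu (fun t => (bump d (x + tau + t))%:C%C) -
                 cintegral mu (fun t => (bump d (x + t))%:C%C)) < d * c) ->
  (exists2 y, csupp mu y & `|z + tau - y| < d) /\
  (exists2 y, csupp mu y & `|z - tau - y| < d).
Proof.
move=> d0 dmu Sz cz tauP.
have zE : cintegral mu (fun t => (bump d (- z + t))%:C%C) = d%:C%C * cmass mu z.
  by rewrite (@cintegral_bump _ _ _ _ _ z) ?opprK// addNr bump_at0// ltW.
have dz : d * c <= Normc.normc (cintegral mu (fun t => (bump d (- z + t))%:C%C)).
  by rewrite zE normc_realM gtr0_norm// ler_pM2l.
split.
- have -> : z + tau = - (- z - tau) by rewrite opprB opprK addrC.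
  apply: cintegral_bump_supp => //; apply/eqP => h0.
  have := tauP (- z - tau); rewrite subrK h0 subr0.
  by rewrite ltNge dz.
- have -> : z - tau = - (- z + tau) by rewrite opprD opprK.
  apply: cintegral_bump_supp => //; apply/eqP => h0.
  have := tauP (- z); rewrite h0 sub0r normcN.
  by rewrite ltNge dz.
Qed.

(** One atom [z] suffices: the almost periods [tau] for the threshold [d * c] are relatively dense,
    and each puts a support point within [d] of [z + tau]. *)
Lemma csupp_dense (R : realType) (p : nat) (mu : cmeasure R p) :
  nonzero_measure mu -> discrete_measure mu -> almost_periodic_measure mu ->
  ball_finite (csupp mu) -> exists l, dense_at (csupp mu) l.
Proof.
move=> nmu dmu apmu Sfin.
have [z Sz] := csupp_nonempty nmu dmu.
(* The radius exceeds the norm of [z], so the ball of radius [d] around [z] contains no other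
   support point. *)
have [d d0 dP] := ball_finite_gap (`|z| + 1) Sfin.
pose c := Normc.normc (cmass mu z).
have c0 : 0 < c.
  rewrite lt0r /c; apply/andP; split; last first.
    by case: (cmass mu z) => a b; exact: sqrtr_ge0.
  by apply: contra_neq Sz => /Normc.eq0_normc.
have /relatively_denseP[l lP] := bump_almost_periods d apmu (mulr_gt0 d0 c0).
exists (l + d) => x.
have [tau tauP xtau] := lP (x - z).
have [|y Sy yd] := (@almost_period_hits _ _ mu d c z tau d0 dmu _ (lexx _) tauP).1.
  move=> y [zy Sy]; apply/esym; apply: dP => //; first by rewrite ltrDl.
  by move: zy; rewrite -ball_normE.
exists y => //.
have -> : x - y = (x - z - tau) + (z + tau - y).
  by apply/rowP => i; rewrite !mxE; ring.
by rewrite (le_lt_trans (ler_normD _ _))// ltrD.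
Qed.

(** The gap of the difference set at 0 separates the whole support uniformly, and the infimum [c]
    bounds all masses from below. Thus one radius [d] and one threshold [d * c] serve every atom at
    once. *)
Lemma csupp_almost_periods (R : realType) (p : nat) (mu : cmeasure R p) (eta : R) :
  discrete_measure mu -> almost_periodic_measure mu ->
  0 < inf [set Normc.normc (cmass mu x) | x in csupp mu] ->
  ball_finite [set x - y | x in csupp mu & y in csupp mu] -> 0 < eta ->
  relatively_dense [set tau | forall x, csupp mu x ->
    (exists2 y, csupp mu y & `|x + tau - y| < eta) /\
    (exists2 y, csupp mu y & `|x - tau - y| < eta)].
Proof.
move=> dmu apmu; set c := inf _ => c0 SS eta0.
have [g g0 gP] := ball_finite_gap 1 SS.
pose d := Num.min eta g.
have d0 : 0 < d by rewrite lt_min eta0.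
have /relatively_denseP[l lP] := bump_almost_periods d apmu (mulr_gt0 d0 c0).
apply/relatively_denseP; exists l => x.
have [tau tauP xtau] := lP x; exists tau => // z Sz.
have [||[y Sy yd] [y' Sy' yd']] := @almost_period_hits _ _ mu d c z tau d0 dmu _ _ tauP.
- move=> y [zy Sy]; apply/esym; apply/eqP; rewrite -subr_eq0; apply/eqP/esym.
  apply: gP; rewrite ?normr0 ?ltr01//.
  + by exists z => //; exists z => //; rewrite subrr.
  + by exists z => //; exists y.
  + by move: zy; rewrite -ball_normE sub0r normrN => /lt_le_trans; apply; rewrite ge_min lexx orbT.
- apply: ge_inf; last by exists z.
  by exists 0 => _ [y _ <-]; case: (cmass mu y) => a b; exact: sqrtr_ge0.
by split; [exists y|exists y'] => //; rewrite (lt_le_trans yd, lt_le_trans yd')//;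
  rewrite ge_min lexx.
Qed.

(** * Lattice structure of the two supports *)

Theorem theorem2 (R : realType) (p : nat) (p_gt0 : (0 < p)%N)
    (mu1 mu2 : cmeasure R p) :
  nonzero_measure mu1 -> nonzero_measure mu2 ->
  almost_periodic_measure mu1 -> almost_periodic_measure mu2 ->
  discrete_measure mu1 -> discrete_measure mu2 ->
  0 < inf [set Normc.normc (cmass mu1 x) | x in csupp mu1] ->
  0 < inf [set Normc.normc (cmass mu2 x) | x in csupp mu2] ->
  ball_finite [set x - y | x in csupp mu1 & y in csupp mu2] ->
  exists (L : set 'rV[R]_p) (r1 r2 : nat)
         (c1 : 'I_r1 -> 'rV[R]_p) (c2 : 'I_r2 -> 'rV[R]_p),
    [/\ full_rank_lattice L, (0 < r1)%N, (0 < r2)%N,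
        csupp mu1 = \bigcup_(k in [set: 'I_r1]) translate L (c1 k) &
        csupp mu2 = \bigcup_(k in [set: 'I_r2]) translate L (c2 k)].
Proof.
move=> nmu1 nmu2 ap1 ap2 dmu1 dmu2 inf1 inf2 D12.
have S1n := csupp_nonempty nmu1 dmu1; have S2n := csupp_nonempty nmu2 dmu2.
have D21 := ball_finite_opp D12.
(* A point of the other support makes each support locally finite, hence relatively dense; the
   density of each then makes the differences within the other locally finite. *)
have [l1 S1l] := csupp_dense nmu1 dmu1 ap1 (ball_finite_minuend S2n D12).
have [l2 S2l] := csupp_dense nmu2 dmu2 ap2 (ball_finite_minuend S1n D21).
have D11 := ball_finite_diff S2l D12; have D22 := ball_finite_diff S1l D21.
have [k1 T1] := dense_periods S1l D11
  (fun _ => csupp_almost_periods dmu1 ap1 inf1 D11).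
have [k2 T2] := dense_periods S2l D22
  (fun _ => csupp_almost_periods dmu2 ap2 inf2 D22).
exact: common_lattice S1n S2n D12 T1 T2.
Qed.
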